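(* Let $A$ be a vector space over a field $\mathbb{K}$ and let $A_i$, $i\in I$, be a finite family of vector subspaces of $A$ generating a distributive lattice. For $\Gamma\in 2^I$ let $A_\Gamma:=\bigcap_{i\in\Gamma}A_i$, with $A_\varnothing:=A$. Then $A$ has a linear basis $\mathcal{B}=\bigcup_{\Gamma\in2^I}\mathcal{B}_\Gamma$, where $\mathcal{B}_\Gamma\subseteq A_\Gamma$ for $\Gamma\in2^I$, such that the subsets $\mathcal{B}_\Gamma$ are all (pairwise) disjoint and $$A_\Gamma=\mathrm{Span}\Big(\bigcup_{\Gamma'\in2^I,\ \Gamma'\supseteq\Gamma}\mathcal{B}_{\Gamma'}\Big)$$ for all $\Gamma\in2^I$.
   Context: $2^I$ denotes the set of all subsets of $I$. The lattice generated by a family of subspaces is taken with respect to the operations $+$ (sum of subspaces) and $\cap$ (intersection). The sets $\mathcal{B}_\Gamma$ are allowed to be empty. *)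

(* Defs.v *)
From mathcomp Require Import all_boot all_order all_algebra.
From mathcomp Require Import boolp classical_sets.

Set Implicit Arguments.
Unset Strict Implicit.
Unset Printing Implicit Defensive.

Import GRing.Theory.

Local Open Scope classical_set_scope.
Local Open Scope ring_scope.

(* Vector spaces may be infinite-dimensional, hence [lmodType K] and Prop-valued
   sets rather than [vectType K] and [{vspace V}]. *)
Definition is_subspace (K : fieldType) (V : lmodType K) (U : set V) : Prop :=
  GRing.submod_closed [in U].

Definition linspan (K : fieldType) (V : lmodType K) (B : set V) : set V :=
  smallest (@is_subspace K V) B.

Definition sum_subspace (K : fieldType) (V : lmodType K) (U W : set V) : set V :=
  [set u + w | u in U & w in W].

Definition lin_indep (K : fieldType) (V : lmodType K) (B : set V) : Prop :=
  forall (s : seq V) (c : V -> K), uniq s -> {in s, forall v, B v} ->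
    \sum_(v <- s) c v *: v = 0 -> {in s, forall v, c v = 0}.

Definition is_basis (K : fieldType) (V : lmodType K) (B : set V) : Prop :=
  lin_indep B /\ linspan B = setT.

Definition lattice_closed (K : fieldType) (V : lmodType K)
    (L : set (set V)) : Prop :=
  forall U W : set V, L U -> L W -> L (sum_subspace U W) /\ L (U `&` W).

(* When every [F i] is a subspace, all members are subspaces: the subspaces of
   [V] are themselves a [lattice_closed] family. *)
Definition generated_lattice (K : fieldType) (V : lmodType K) (I : finType)
    (F : I -> set V) : set (set V) :=
  smallest (@lattice_closed K V) (range F).

Definition distributive_lattice (K : fieldType) (V : lmodType K)
    (L : set (set V)) : Prop :=
  forall U W X : set V, L U -> L W -> L X ->
    U `&` sum_subspace W X = sum_subspace (U `&` W) (U `&` X).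

(* For [G = set0] this is the whole space [setT]. *)
Definition capF (K : fieldType) (V : lmodType K) (I : finType)
    (F : I -> set V) (G : {set I}) : set V :=
  \bigcap_(i in [set` G]) F i.

(* Main.v *)
Require Import Defs.
From mathcomp Require Import all_boot all_order all_algebra.
From mathcomp Require Import boolp classical_sets.

(** Write [A_G] for [capF F G], and let [A'_G] be the sum of the subspaces
    [A_G `&` F i = A_(i |: G)] for [i] outside [G], that is, the part of [A_G]
    already accounted for by larger index sets.  Choose [B_G] as a basis of
    [A_G] modulo [A'_G]; it exists by Zorn's lemma ([exists_basis_mod]).

    For spanning, [A_G] is spanned by [B_G] and by the [A_(i |: G)], so
    descending induction on [G] shows that it is spanned by the [B_G'] with
    [G \subset G'] ([capF_sub_span]).

    Independence rests on the distributivity identity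
      [A_G `&` \sum_(i \notin G) F i = A'_G]   ([capF_cap_sum]).
    In a linear relation among elements of the union of the [B_G], suppose that
    the coefficients over all index sets of size less than [#|G|] vanish.  Every
    remaining term outside [B_G] belongs to some [B_G'] with [G'] not included
    in [G], hence to some [F i] with [i \notin G].  So the part of the relation
    supported on [B_G] lies both in [A_G] and in [\sum_(i \notin G) F i], hence
    in [A'_G], and its coefficients vanish because [B_G] is independent modulo
    [A'_G] ([levels_indep]).  The sets [B_G] are disjoint because
    [A_G `&` A_G'] is contained in [A'_G] as soon as [G'] is not included in
    [G]. *)

Set Implicit Arguments.
Unset Strict Implicit.
Unset Printing Implicit Defensive.

Import GRing.Theory.

Local Open Scope classical_set_scope.
Local Open Scope ring_scope.

(** * Subspaces, spans and finite sums *)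

Section Subspaces.
Variables (K : fieldType) (V : lmodType K).
Implicit Types (U W X B : set V) (u v w x : V).

Lemma subspaceP U :
  is_subspace U <-> U 0 /\ forall (a : K) u v, U u -> U v -> U (a *: u + v).
Proof.
split=> [[U0 UL]|[U0 UL]].
  split=> [|a u v Uu Uv]; first by move: U0; rewrite in_setE.
  by have := UL a u v; rewrite !in_setE; apply.
by split=> [|a u v]; rewrite !in_setE //; apply: UL.
Qed.

Lemma subspace0 U : is_subspace U -> U 0.
Proof. by case/subspaceP. Qed.

Lemma subspaceD U u v : is_subspace U -> U u -> U v -> U (u + v).
Proof. by case/subspaceP=> _ UL Uu Uv; rewrite -[u]scale1r; apply: UL. Qed.

Lemma subspaceZ U (a : K) u : is_subspace U -> U u -> U (a *: u).
Proof. by case/subspaceP=> U0 UL Uu; rewrite -[_ *: _]addr0; apply: UL. Qed.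

Lemma subspaceN U u : is_subspace U -> U u -> U (- u).
Proof. by move=> Us Uu; rewrite -scaleN1r; apply: subspaceZ. Qed.

Lemma subspace_sum U (J : eqType) (s : seq J) (P : pred J) (f : J -> V) :
  is_subspace U -> {in s, forall j, P j -> U (f j)} ->
  U (\sum_(j <- s | P j) f j).
Proof.
move=> Us Uf; rewrite big_seq_cond.
apply: big_ind => [|u v|j /andP[js Pj]]; first exact: subspace0.
- exact: subspaceD.
- exact: Uf.
Qed.

Lemma subspace_set0 : is_subspace [set (0 : V)].
Proof. by apply/subspaceP; split=> // a u v -> ->; rewrite scaler0 addr0. Qed.

Lemma subspaceI U W : is_subspace U -> is_subspace W -> is_subspace (U `&` W).
Proof.
move=> /subspaceP[U0 UL] /subspaceP[W0 WL]; apply/subspaceP; split=> //.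
by move=> a u v [Uu Wu] [Uv Wv]; split; [apply: UL|apply: WL].
Qed.

Lemma subspace_sum_subspace U W :
  is_subspace U -> is_subspace W -> is_subspace (sum_subspace U W).
Proof.
move=> Us Ws; apply/subspaceP; split.
  by exists 0; [exact: subspace0|exists 0; [exact: subspace0|rewrite addr0]].
move=> a _ _ [u1 U1 [w1 W1 <-]] [u2 U2 [w2 W2 <-]].
exists (a *: u1 + u2); first by apply: subspaceD => //; apply: subspaceZ.
exists (a *: w1 + w2); first by apply: subspaceD => //; apply: subspaceZ.
by rewrite scalerDr addrACA.
Qed.

Lemma sum_subspace0r U : sum_subspace U [set 0] = U.
Proof.
apply/seteqP; split=> [_ [u Uu [_ -> <-]]|u Uu]; first by rewrite addr0.
by exists u => //; exists 0 => //; rewrite addr0.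
Qed.

Lemma sum_subspace_subl U W : is_subspace W -> U `<=` sum_subspace U W.
Proof.
by move=> Ws u Uu; exists u => //; exists 0; [exact: subspace0|rewrite addr0].
Qed.

Lemma sum_subspace_subr U W : is_subspace U -> W `<=` sum_subspace U W.
Proof.
by move=> Us w Ww; exists 0; [exact: subspace0|exists w => //; rewrite add0r].
Qed.

Lemma subspace_span B : is_subspace (linspan B).
Proof.
apply/subspaceP; split=> [M [Ms _]|a u v Bu Bv M [Ms BM]]; first exact: subspace0.
apply: subspaceD => //; last exact: Bv.
by apply: subspaceZ => //; apply: Bu.
Qed.

Lemma span_sub B U : is_subspace U -> B `<=` U -> linspan B `<=` U.
Proof. exact: smallest_sub. Qed.

Lemma sub_span B : B `<=` linspan B.
Proof. exact: sub_gen_smallest. Qed.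

Lemma span_mono B B' : B `<=` B' -> linspan B `<=` linspan B'.
Proof.
move=> BB'; apply: span_sub; first exact: subspace_span.
by apply: (subset_trans BB'); apply: sub_span.
Qed.

(** Binary sums iterated from [[set 0]], the form to which distributivity
    applies. *)
Definition bigsum (I : finType) (P : pred I) (F : I -> set V) : set V :=
  \big[@sum_subspace K V/[set 0]]_(i | P i) F i.

Section BigSum.
Variables (I : finType) (P : pred I) (F : I -> set V).

Lemma subspace_bigsum :
  (forall i, P i -> is_subspace (F i)) -> is_subspace (bigsum P F).
Proof.
move=> Fs; apply: big_ind => //; first exact: subspace_set0.
exact: subspace_sum_subspace.
Qed.

Lemma bigsum_sub U : is_subspace U -> (forall i, P i -> F i `<=` U) ->
  bigsum P F `<=` U.
Proof.
move=> Us FU; apply: (big_ind (fun A : set V => A `<=` U)) =>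
  [_ ->|A B AU BU _ [a Aa [b Bb <-]]|//].
  exact: subspace0.
by apply: subspaceD; [|exact: AU|exact: BU].
Qed.

Lemma sub_bigsum i : (forall j, is_subspace (F j)) -> P i -> F i `<=` bigsum P F.
Proof.
move=> Fs Pi; rewrite /bigsum; have := mem_index_enum i.
elim: (index_enum I) => // j r IHr; rewrite inE big_cons.
have bs (Q : pred I) :
    is_subspace (\big[@sum_subspace K V/[set 0]]_(k <- r | Q k) F k).
  by apply: big_ind => //; [exact: subspace_set0|exact: subspace_sum_subspace].
case/predU1P=> [<-|ir]; first by rewrite Pi; apply: sum_subspace_subl.
case: ifP => _; last exact: IHr.
by apply: (subset_trans (IHr ir)); apply: sum_subspace_subr.
Qed.

End BigSum.

(** * Bases modulo a subspace *)

(** Freeness in the quotient [V / W], phrased with representatives so that no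
    quotient module is formed; distinct elements of [B] have distinct classes. *)
Definition indep_mod W B : Prop :=
  forall (s : seq V) (c : V -> K), uniq s -> {in s, forall v, B v} ->
    W (\sum_(v <- s) c v *: v) -> {in s, forall v, c v = 0}.

Lemma indep_mod_notin W B v : indep_mod W B -> B v -> ~ W v.
Proof.
move=> Bi Bv Wv; have /eqP := oner_neq0 K; apply.
apply: (Bi [:: v] (fun=> 1) _ _ _ v) => //.
- by move=> u; rewrite inE => /eqP ->.
- by rewrite big_seq1 scale1r.
- exact: mem_head.
Qed.

(** If [u] had a nonzero coefficient in a combination lying in [W], dividing by
    it would put [u] in the span of [W] and [B]. *)
Lemma indep_mod_setU1 W B u : is_subspace W -> indep_mod W B ->
  ~ linspan (W `|` B) u -> indep_mod W (u |` B).
Proof.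
move=> Ws Bi uNspan s c us sB Wsum.
have sB' v : v \in s -> v != u -> B v by move=> /sB [->|//]; rewrite eqxx.
have [us'|uNs] := boolP (u \in s); last first.
  by apply: Bi => // v vs; apply: sB' => //; apply: contraNneq uNs => <-.
have remB : {in rem u s, forall v, B v}.
  by move=> v; rewrite mem_rem_uniq // !inE => /andP[vu vs]; apply: sB'.
move: Wsum; rewrite (perm_big _ (perm_to_rem us')) big_cons /=.
set t := \sum_(v <- rem u s) _ => Wsum.
have Ss := subspace_span (W `|` B).
have cu0 : c u = 0.
  apply/eqP/negPn/negP => cu0; apply: uNspan.
  rewrite -[u]scale1r -(mulVf cu0) -scalerA; apply: (subspaceZ _ Ss).
  rewrite -(addrK t (c u *: u)); apply: (subspaceD Ss).
    by apply: sub_span; left.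
  apply: (subspaceN Ss); apply: (subspace_sum Ss) => v /remB Bv _.
  by apply: (subspaceZ _ Ss); apply: sub_span; right.
move: Wsum; rewrite cu0 scale0r add0r => Wt v vs.
have [->//|vu] := eqVneq v u.
apply: (Bi (rem u s)) => //; first exact: rem_uniq.
by rewrite mem_rem_uniq // !inE vu.
Qed.

(** A maximal subset of [U] independent modulo [W] works; chains have upper
    bounds because a finite sequence drawn from the union of a chain lies in
    one member of it. *)
Lemma exists_basis_mod U W : is_subspace W ->
  exists B, [/\ B `<=` U, indep_mod W B & U `<=` linspan (W `|` B)].
Proof.
move=> Ws; pose P B := B `<=` U /\ indep_mod W B.
have [C CP tot|B [[BU Bi] Bmax]] := @Zorn_bigcup V P.
  split=> [v [X /CP[XU _] /XU //]|s c us sC Wsum].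
  have [->//|s0] := eqVneq s [::].
  suff [X CX sX] : exists2 X, C X & {in s, forall v, X v}.
    by apply: (CP X CX).2.
  elim: s s0 sC {us Wsum} => // v s IHs _ sC.
  have [X CX Xv] := sC v (mem_head v s).
  have [->|s0] := eqVneq s [::].
    by exists X => // w; rewrite inE => /eqP ->.
  have [w ws|Y CY sY] := IHs s0; first by apply: sC; rewrite inE ws orbT.
  have [XY|YX] := tot X Y CX CY.
    by exists Y => // w; rewrite inE => /predU1P[->|/sY//]; apply: XY.
  by exists X => // w; rewrite inE => /predU1P[->//|/sY]; apply: YX.
exists B; split=> // u Uu; apply: contrapT => uNspan.
apply: (Bmax (u |` B)); last first.
  split; last exact: indep_mod_setU1.
  by move=> v [->|/BU].
split; first by move=> v; right.
by move=> /(_ u (or_introl erefl)) Bu; apply: uNspan; apply: sub_span; right.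
Qed.

End Subspaces.

(** * Intersections and sums in a distributive family *)

Section DistributiveFamily.
Variables (K : fieldType) (V : lmodType K) (I : finType) (F : I -> set V).
Hypothesis hsub : forall i : I, is_subspace (F i).
Implicit Types (G : {set I}) (L : set (set V)).

Lemma subspace_capF G : is_subspace (capF F G).
Proof.
apply/subspaceP; split=> [i _|a u v Gu Gv i Gi]; first exact: subspace0.
by apply: subspaceD => //; [apply: subspaceZ => //; apply: Gu|apply: Gv].
Qed.

Lemma capF_mono G G' : G \subset G' -> capF F G' `<=` capF F G.
Proof. by move=> /fintype.subsetP GG' v Gv i /GG'; apply: Gv. Qed.

Lemma capF_setU1 i G : capF F (i |: G) = capF F G `&` F i.
Proof.
apply/seteqP; split=> v; first move=> Gv; first split.
- by apply: capF_mono Gv; apply: finset.subsetUr.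
- by apply: Gv; rewrite /= setU11.
- by move=> [Gv Fv] j /=; rewrite !inE => /predU1P[->|/Gv].
Qed.

(** The empty intersection [setT] is set apart because a lattice containing the
    [F i] need not contain it. *)
Lemma capF_lattice L : lattice_closed L -> (forall i, L (F i)) ->
  forall G, G = finset.set0 \/ L (capF F G).
Proof.
move=> Lc LF G.
have -> : G = [set:: enum G]%SET by apply/setP=> i; rewrite inE mem_enum.
elim: (enum G) => [|i r IHr]; first by left; apply/setP=> i; rewrite !inE.
right; rewrite set_cons capF_setU1.
case: IHr => [->|Lr]; last by case: (Lc _ _ Lr (LF i)).
suff -> : capF F finset.set0 = setT by rewrite setTI.
by apply/seteqP; split=> // v _ j; rewrite /= inE.
Qed.

(** The sum of no subspaces is [[set 0]], which [L] may fail to contain, so the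
    induction carries a disjunction.  It covers [L (bigsum P F)] because the
    distributive law is applied to partial sums as well. *)
Lemma cap_bigsum L U (P : pred I) : lattice_closed L -> distributive_lattice L ->
  (forall i, L (F i)) -> is_subspace U -> L U ->
  U `&` bigsum P F = bigsum P (fun i => U `&` F i).
Proof.
move=> Lc Ld LF Us LU; rewrite /bigsum.
pose R (A A' : set V) := (A = [set 0] \/ L A) /\ U `&` A = A'.
apply: (proj2 (_ : R _ _)).
apply: big_rec2 => [|i A A' _ [HA <-]].
  split; first by left.
  by apply/seteqP; split=> [v []//|_ ->]; split=> //; apply: subspace0.
case: HA => [->|LA]; last first.
  by split; [right; case: (Lc _ _ (LF i) LA)|exact: Ld].
rewrite sum_subspace0r; split; first by right.
suff -> : U `&` [set 0] = [set 0] by rewrite sum_subspace0r.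
by apply/seteqP; split=> [v []//|_ ->]; split=> //; apply: subspace0.
Qed.

Hypothesis hdistr : distributive_lattice (generated_lattice F).

(** The sum of all [A_G'] with [G'] properly containing [G]; one-element
    extensions suffice, and written as [A_G `&` F i] they have the shape in which
    the distributive law produces them. *)
Definition upper G : set V :=
  bigsum (fun i => i \notin G) (fun i => capF F G `&` F i).

Lemma subspace_upper G : is_subspace (upper G).
Proof.
by apply: subspace_bigsum => i _; apply: subspaceI => //; apply: subspace_capF.
Qed.

Lemma capF_cap_sum G :
  capF F G `&` bigsum (fun i => i \notin G) F = upper G.
Proof.
have Lc : lattice_closed (generated_lattice F).
  move=> U W LU LW; split=> M [Mc FM].
    by case: (Mc U W (LU M (conj Mc FM)) (LW M (conj Mc FM))).
  by case: (Mc U W (LU M (conj Mc FM)) (LW M (conj Mc FM))).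
have LF i : generated_lattice F (F i) by apply: sub_gen_smallest; exists i.
have [->|LG] := capF_lattice Lc LF G; last first.
  exact: (cap_bigsum _ Lc hdistr LF (subspace_capF G) LG).
have c0 : capF F finset.set0 = setT.
  by apply/seteqP; split=> // v _ j; rewrite /= inE.
by rewrite /upper c0 setTI; congr bigsum; apply/funext => i; rewrite setTI.
Qed.

Lemma capF_cap_sub_upper G G' :
  ~~ (G' \subset G) -> capF F G `&` capF F G' `<=` upper G.
Proof.
case/fintype.subsetPn=> i G'i Gi v [Gv G'v]; rewrite -capF_cap_sum; split=> //.
by apply: (sub_bigsum (P := fun i => i \notin G) hsub Gi); apply: G'v.
Qed.

(** * Assembling the basis *)

Section Levels.
Variable B : {set I} -> set V.
Hypothesis BF : forall G, B G `<=` capF F G.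

(** Descending induction on [G]: [#|~: G|] decreases when an element
    outside [G] is added. *)
Lemma capF_sub_span G : (forall G, capF F G `<=` linspan (upper G `|` B G)) ->
  capF F G `<=` linspan (\bigcup_(G' in [set G' : {set I} | G \subset G']) B G').
Proof.
move=> Bspan; have [n] := ubnP #|~: G|; elim: n G => // n IHn G leGn.
apply: (subset_trans (Bspan G)); apply: span_sub; first exact: subspace_span.
move=> v [|Bv]; last by apply: sub_span; exists G => /=.
apply: bigsum_sub; first exact: subspace_span.
move=> i Gi; rewrite -capF_setU1.
have lt : (#|~: (i |: G)| < n)%N.
  rewrite -ltnS; apply: leq_trans leGn; rewrite ltnS.
  rewrite finset.setCU finset.setIC -finset.setDE.
  by rewrite (cardsD1 i (~: G)) inE Gi.
apply: (subset_trans (IHn _ lt)); apply: span_mono.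
move=> w [G' /= sG' Bw]; exists G' => //=.
by apply: fintype.subset_trans sG'; apply: finset.subsetUr.
Qed.

Hypothesis Bi : forall G, indep_mod (upper G) (B G).

Lemma levels_disjoint : trivIset [set: {set I}] B.
Proof.
have sub G G' v : B G v -> B G' v -> G' \subset G.
  move=> Bv B'v; apply/negPn/negP => nsub.
  apply: (indep_mod_notin (@Bi G) Bv); apply: (capF_cap_sub_upper nsub).
  by split; apply: BF.
move=> G G' _ _ [v [Bv B'v]].
by apply/eqP; rewrite finset.eqEsubset (sub G' G v) // (sub G G' v).
Qed.

(** Strong induction on [#|g v|], where [g] picks for each vector an index set
    whose level contains it. *)
Lemma levels_indep : lin_indep (\bigcup_(G in [set: {set I}]) B G).
Proof.
move=> s c us sB sum0.
have [g gB] : exists g : V -> {set I}, {in s, forall v, B (g v) v}.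
  suff /choice[g gB] : forall v, exists G, v \in s -> B G v by exists g.
  move=> v; have [vs|] := boolP (v \in s); last by exists finset.set0.
  by have [G _ Bv] := sB v vs; exists G.
move=> v; have [n] := ubnP #|g v|; elim: n v => // n IHn v levn vs.
pose G := g v.
have Gs : uniq [seq u <- s | g u == G] by apply: filter_uniq.
have vG : v \in [seq u <- s | g u == G] by rewrite mem_filter eqxx.
apply: (Bi (G := G) Gs _ _ vG).
  by move=> u; rewrite mem_filter => /andP[/eqP <- /gB].
rewrite big_filter -capF_cap_sum; split.
  apply: subspace_sum; first exact: subspace_capF.
  move=> u us' /eqP <-; apply: (subspaceZ _ (subspace_capF _)).
  by apply: BF; apply: gB.
have Ss : is_subspace (bigsum (fun i => i \notin G) F) by apply: subspace_bigsum.
move: sum0; rewrite (bigID (fun u => g u == G)) /= => /eqP.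
rewrite addr_eq0 => /eqP ->; apply: subspaceN => //; apply: subspace_sum => //.
move=> u us' guG; have [ltuG|leGu] := ltnP #|g u| #|G|.
  rewrite IHn ?scale0r //; first exact: subspace0.
  exact: leq_trans ltuG levn.
(* [g u] is at least as large as [G] and different from it, so it has an
   element outside [G]. *)
have /fintype.subsetPn[i gi Gi] : ~~ (g u \subset G).
  by apply: contra guG => sub; rewrite finset.eqEcard sub.
apply: (subspaceZ _ Ss); apply: (sub_bigsum (P := fun i => i \notin G) hsub Gi).
by apply: (BF (gB u us')).
Qed.

End Levels.
End DistributiveFamily.

Theorem lemma1 (K : fieldType) (V : lmodType K) (I : finType) (F : I -> set V)
    (hsub : forall i : I, is_subspace (F i))
    (hdistr : distributive_lattice (generated_lattice F)) :
  exists B : {set I} -> set V,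
    [/\ forall G : {set I}, B G `<=` capF F G,
        trivIset [set: {set I}] B,
        is_basis (\bigcup_(G in [set: {set I}]) B G) &
        forall G : {set I},
          capF F G =
          linspan (\bigcup_(G' in [set G' : {set I} | G \subset G']) B G')].
Proof.
have /choice[B BP] := fun G => exists_basis_mod (capF F G) (subspace_upper hsub G).
have BF G : B G `<=` capF F G by case: (BP G).
have Bi G : indep_mod (upper F G) (B G) by case: (BP G).
have Bspan G : capF F G `<=` linspan (upper F G `|` B G) by case: (BP G).
exists B; split=> //.
- exact: (levels_disjoint hsub hdistr BF Bi).
- split; first exact: (levels_indep hsub hdistr BF Bi).
  apply/seteqP; split=> // v _.
  have : capF F finset.set0 v by move=> i; rewrite /= inE.
  by move=> /(capF_sub_span Bspan); apply: span_mono => w [G _ Bw]; exists G.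
- move=> G; apply/seteqP; split; first exact: (capF_sub_span Bspan).
  apply: span_sub; first exact: subspace_capF.
  by move=> v [G' /= sub /BF]; apply: capF_mono.
Qed.
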